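(* Let $(\Omega,\Sigma,P)$ be a probability space and let $(\psi_n)_{n\ge 1}$ be an independent sequence of Bernoulli random variables on $\Omega$, each taking only the values $0$ and $1$, each value with probability $\frac12$. Then for every infinite-dimensional real Banach space $X$ there exist a sequence $(V_n)_{n\ge1}$ of finite-dimensional compact convex subsets of the unit ball of $X$ and an $\varepsilon>0$ such that, for the random sets $\Psi_n=\psi_n\cdot V_n$ (whose expectations are $E(\Psi_n)=\frac12 V_n$), $$ \rho_H\left(\frac{1}{4^n}\sum_{i=1}^{4^n}\Psi_i(\omega),\ \frac{1}{4^n}\sum_{i=1}^{4^n}E(\Psi_i)\right)=\rho_H\left(\frac{1}{4^n}\sum_{i=1}^{4^n}\psi_i(\omega)V_i,\ \frac{1}{4^n\cdot 2}\sum_{i=1}^{4^n}V_i\right)\ \ge\ \varepsilon $$ at every point $\omega\in\Omega$ and for all $n\in\mathbb{N}$. In particular, for every $\omega\in\Omega$, $$ \rho_H\left(\frac1N\sum_{i=1}^N\Psi_i(\omega),\ \frac1N\sum_{i=1}^N E(\Psi_i)\right)\not\to 0\quad\text{as } N\to\infty . $$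
   Context: Sums of sets are Minkowski sums $A+B=\{a+b: a\in A, b\in B\}$, and $tA=\{ta:a\in A\}$ for $t\ge0$ (so $0\cdot V=\{0\}$ for nonempty $V$). A set is called finite-dimensional if it is contained in a finite-dimensional subspace; the sets $V_n$ are nonempty. For nonempty bounded $A,B\subset X$, $\rho_H(A,B)=\max\{\sup_{b\in B}\inf_{a\in A}\|a-b\|,\ \sup_{a\in A}\inf_{b\in B}\|a-b\|\}$ is the Hausdorff distance. Expectation of random sets: $BC(X)$ is the set of nonempty bounded convex subsets of $X$ modulo the relation $A\approx B\iff\rho_H(A,B)=0$; $Z(X)$ is the Banach space of bounded continuous real functions on the unit sphere $S_{X^*}$ with the sup norm; the Rådström embedding $R:BC(X)\to Z(X)$ is $(R(A))(x^* )=\sup_{a\in A}x^*(a)$. A multifunction $F:\Omega\to BC(X)$ has expectation $E(F)=A\in BC(X)$ if $R\circ F$ is Bochner integrable with integral $R(A)$; for $F=\sum_i U_i\mathbf 1_{\Delta_i}$ simple, $E(F)=\sum_i P(\Delta_i)U_i$. *)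

(* Defs.v *)
From HB Require Import structures.
From mathcomp Require Import all_boot all_order all_algebra.
From mathcomp Require Import finmap.
From mathcomp Require Import all_classical all_reals all_analysis.

Set Implicit Arguments.
Unset Strict Implicit.
Unset Printing Implicit Defensive.

Import Order.TTheory GRing.Theory Num.Theory.
Import numFieldNormedType.Exports.

Local Open Scope classical_set_scope.
Local Open Scope ring_scope.

Section SupNorm.
Context {R : realType} {T : Type} (A : set T).
Implicit Types f g : T -> R.

Definition bounded_on f := exists M : R, forall x, A x -> `|f x| <= M.

Definition supnorm f : R := sup [set `|f x| | x in A].

Lemma supnorm_ub f x : bounded_on f -> A x -> `|f x| <= supnorm f.
Proof.
move=> [M fM] Ax; apply: ub_le_sup; last by exists x.
by exists M => _ [y Ay <-]; exact: fM.
Qed.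

Lemma supnorm_ge0 f : 0 <= supnorm f.
Proof.
have [[[_ [x Ax _]] hub]|ns] := pselect (has_sup [set `|f x| | x in A]).
  by rewrite (le_trans (normr_ge0 (f x)))//; apply: (ub_le_sup hub); exists x.
by rewrite /supnorm sup_out.
Qed.

Lemma supnorm_le f (M : R) :
  0 <= M -> (forall x, A x -> `|f x| <= M) -> supnorm f <= M.
Proof.
move=> M0 fM; have [A0|/set0P[a Aa]] := eqVneq A set0.
  by rewrite /supnorm A0 image_set0 sup0.
apply: ge_sup; first by exists `|f a|, a.
by move=> _ [x Ax <-]; exact: fM.
Qed.

Lemma supnormD f g : bounded_on f -> bounded_on g ->
  supnorm (fun x => f x + g x) <= supnorm f + supnorm g.
Proof.
move=> fb gb; apply: supnorm_le => [|x Ax]; first by rewrite addr_ge0 ?supnorm_ge0.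
by rewrite (le_trans (ler_normD _ _))// lerD// supnorm_ub.
Qed.

Lemma supnormZ (a : R) f : bounded_on f ->
  supnorm (fun x => a * f x) = `|a| * supnorm f.
Proof.
move=> fb; have le b g : bounded_on g ->
    supnorm (fun x => b * g x) <= `|b| * supnorm g.
  move=> gb; apply: supnorm_le => [|x Ax]; first by rewrite mulr_ge0 ?supnorm_ge0.
  by rewrite normrM ler_wpM2l// supnorm_ub.
apply/eqP; rewrite eq_le le//=; have [->|a0] := eqVneq a 0.
  by rewrite normr0 mul0r supnorm_ge0.
have afb : bounded_on (fun x => a * f x).
  by case: fb => M fM; exists (`|a| * M) => x Ax; rewrite normrM ler_wpM2l ?fM.
have := le a^-1 _ afb; rewrite normfV ler_pdivlMl ?normr_gt0//.
by under eq_fun do rewrite mulKf//.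
Qed.

End SupNorm.

(* X^*: the continuous linear functionals with the operator norm. *)
Section CDual.
Context {R : realType} (X : normedModType R).

Definition cdual_pred : {pred X -> R^o} :=
  [pred f | `[< linear f /\ continuous f >]].

Record cdual := CDual {
  cdual_fun :> X -> R^o ;
  cdual_funP : cdual_fun \in cdual_pred }.

HB.instance Definition _ := [isSub for cdual_fun].
HB.instance Definition _ := [Choice of cdual by <:].

Lemma cdual_pred_submod : submod_closed cdual_pred.
Proof.
split.
  apply/asboolP; split; first by move=> a x y; rewrite scaler0 addr0.
  exact: cst_continuous.
move=> a f g /asboolP[fl fc] /asboolP[gl gc]; apply/asboolP; split.
  move=> b x y; rewrite !fctE fl gl !scalerDr !scalerA mulrC.
  by rewrite [RHS]addrACA.
by move=> x; apply: cvgD; [apply: cvgZr; exact: fc|exact: gc].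
Qed.

HB.instance Definition _ :=
  GRing.isSubmodClosed.Build R (X -> R^o) cdual_pred cdual_pred_submod.
HB.instance Definition _ := [SubChoice_isSubLmodule of cdual by <:].

Let B := [set x : X | `|x| <= 1].

Definition opnorm (f : cdual) : R := supnorm B f.

Lemma cdual_linear (f : cdual) : linear f.
Proof. by have /asboolP[] := cdual_funP f. Qed.

Lemma cdual_bounded (f : cdual) : bounded_on B f.
Proof.
have /asboolP[fl fc] := cdual_funP f.
pose l : {linear X -> R^o} :=
  HB.pack (cdual_fun f) (GRing.isLinear.Build R X R^o *:%R (cdual_fun f) fl).
have : bounded_near l (nbhs (0 : X)) by apply: continuous_linear_bounded; exact: fc.
move=> /bounded_funP/(_ 1)[M fM]; exists M => x; exact: fM.
Qed.

Lemma opnormD (f g : cdual) : opnorm (f + g) <= opnorm f + opnorm g.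
Proof. exact: (supnormD (cdual_bounded f) (cdual_bounded g)). Qed.

Lemma opnormZ (a : R) (f : cdual) : opnorm (a *: f) = `|a| * opnorm f.
Proof. exact: (supnormZ a (cdual_bounded f)). Qed.

Lemma opnorm_ub (f : cdual) x : `|f x| <= opnorm f * `|x|.
Proof.
have f0 : f 0 = 0.
  have := cdual_linear f 1 0 0; rewrite !scale1r addr0 => /eqP.
  by rewrite -[X in X == _]addr0 (inj_eq (addrI _)) eq_sym => /eqP.
have [->|x0] := eqVneq x 0; first by rewrite f0 !normr0 mulr0.
rewrite -ler_pdivrMr ?normr_gt0// mulrC -[in leLHS](normr_id x) -normfV -normrM.
have -> : `|x|^-1 * f x = f (`|x|^-1 *: x).
  by have := cdual_linear f `|x|^-1 x 0; rewrite !addr0 f0 addr0.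
apply: (supnorm_ub (cdual_bounded f)).
by rewrite /B/= normrZ normfV normr_id mulVf ?normr_eq0.
Qed.

Lemma opnorm_eq0 (f : cdual) : opnorm f = 0 -> f = 0.
Proof.
move=> f0; apply/val_inj/funext => x; apply/eqP; rewrite -normr_le0.
by have := opnorm_ub f x; rewrite f0 mul0r.
Qed.

HB.instance Definition _ :=
  Lmodule_isNormed.Build R cdual opnormD opnormZ opnorm_eq0.

(* The coercion of a set to a type carries the subspace topology, so
   [cdual_sphere] is S_{X^*} with the topology of the norm of X^*. *)
Definition cdual_sphere : set cdual := [set f | `|f| = 1].

End CDual.
Arguments cdual_sphere {R} X.

(* Z(X): the bounded continuous real functions on S_{X^*}, sup norm. *)
Section ZSpace.
Context {R : realType} (X : normedModType R).
Local Notation S := (set_type (cdual_sphere X)).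

Definition zspace_pred : {pred S -> R^o} :=
  [pred z | `[< bounded_on [set: S] (z : S -> R) /\ continuous z >]].

Record zspace := ZSpace {
  zspace_fun :> S -> R^o ;
  zspace_funP : zspace_fun \in zspace_pred }.

HB.instance Definition _ := [isSub for zspace_fun].
HB.instance Definition _ := [Choice of zspace by <:].

Lemma zspace_pred_submod : submod_closed zspace_pred.
Proof.
split.
  apply/asboolP; split; last exact: cst_continuous.
  by exists 0 => x _; rewrite normr0.
move=> a f g /asboolP[[M fM] fc] /asboolP[[N gN] gc]; apply/asboolP; split.
  exists (`|a| * M + N) => x Sx; rewrite (le_trans (ler_normD _ _))// lerD ?gN//.
  by rewrite normrZ ler_wpM2l ?fM.
move=> x; have Fx := @nbhs_filter S x.
apply: (@cvgD _ _ _ (nbhs x) Fx); last exact: gc.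
by apply: (@cvgZr _ _ _ (nbhs x) Fx); exact: fc.
Qed.

HB.instance Definition _ :=
  GRing.isSubmodClosed.Build R (S -> R^o) zspace_pred zspace_pred_submod.
HB.instance Definition _ := [SubChoice_isSubLmodule of zspace by <:].

Definition znorm (z : zspace) : R := supnorm [set: S] z.

Lemma zspace_bounded (z : zspace) : bounded_on [set: S] z.
Proof. by have /asboolP[] := zspace_funP z. Qed.

Lemma znormD (f g : zspace) : znorm (f + g) <= znorm f + znorm g.
Proof. exact: (supnormD (zspace_bounded f) (zspace_bounded g)). Qed.

Lemma znormZ (a : R) (f : zspace) : znorm (a *: f) = `|a| * znorm f.
Proof. exact: (supnormZ a (zspace_bounded f)). Qed.

Lemma znorm_eq0 (f : zspace) : znorm f = 0 -> f = 0.
Proof.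
move=> f0; apply/val_inj/funext => x; apply/eqP; rewrite -normr_le0 -f0.
exact: (supnorm_ub (zspace_bounded f)).
Qed.

HB.instance Definition _ :=
  Lmodule_isNormed.Build R zspace znormD znormZ znorm_eq0.

End ZSpace.
Arguments zspace {R} X.
Arguments zspace_pred {R} X.

Section Sets.
Context {R : realType} {X : normedModType R}.
Implicit Types A B : set X.

Definition mink_add A B : set X := [set a + b | a in A & b in B].

Definition mink_scale (t : R) A : set X := [set t *: a | a in A].

Definition lin_span (s : seq X) : set X :=
  [set x | exists c : 'I_(size s) -> R, x = \sum_(i < size s) c i *: s`_i].

Definition finite_dim A := exists s : seq X, A `<=` lin_span s.

(* The real-valued [sup] and [inf] give the usual value when A and B are
   nonempty and bounded; this is the only case of interest. *)
Definition hausdorff_dist A B : R :=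
  Num.max (sup [set inf [set `|a - b| | a in A] | b in B])
          (sup [set inf [set `|a - b| | b in B] | a in A]).

End Sets.

Notation "\mink_ ( i < n ) F" := (\big[mink_add/[set 0]]_(i < n) F)
  (at level 41, F at level 41, i, n at level 50,
   format "'[' \mink_ ( i  <  n ) '/  '  F ']'").

(* BC(X) is represented by representatives: no quotient by
   [hausdorff_dist A B = 0] is taken. *)
Section Radstrom.
Context {R : realType} (X : normedModType R).

Record bcset := BCSet {
  bc_set : set X ;
  bc_nonempty : bc_set !=set0 ;
  bc_bounded : bounded_set bc_set ;
  bc_convex : convex_set bc_set }.

Variable A : bcset.

Definition support_fun (f : set_type (cdual_sphere X)) : R :=
  sup [set (set_val f : cdual X) a | a in bc_set A].

Lemma bcset_norm : exists2 M : R, 0 < M & forall a, bc_set A a -> `|a| <= M.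
Proof. by have /pinfty_ex_gt0[M M0 AM] := bc_bounded A; exists M. Qed.

Lemma support_has_sup (f : cdual X) : has_sup [set f a | a in bc_set A].
Proof.
have [M M0 AM] := bcset_norm; have [a Aa] := bc_nonempty A.
split; first by exists (f a), a.
exists (opnorm f * M) => _ [b Ab <-].
rewrite (le_trans (ler_norm _))// (le_trans (opnorm_ub f b))//.
by rewrite ler_wpM2l ?AM// supnorm_ge0.
Qed.

Lemma support_lip (f g : cdual X) (M : R) : (forall a, bc_set A a -> `|a| <= M) ->
  sup [set f a | a in bc_set A]
    <= sup [set g a | a in bc_set A] + opnorm (f - g) * M.
Proof.
move=> AM; apply: ge_sup; first by have [] := support_has_sup f.
move=> _ [a Aa <-].
have -> : f a = g a + (f - g) a by rewrite [(f - g) a]/= addrC subrK.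
apply: lerD.
  by apply: ub_le_sup; [have [] := support_has_sup g|exists a].
rewrite (le_trans (ler_norm _))// (le_trans (opnorm_ub _ a))//.
by rewrite ler_wpM2l ?AM// supnorm_ge0.
Qed.

Lemma support_zspace : support_fun \in zspace_pred X.
Proof.
have [M M0 AM] := bcset_norm.
apply/asboolP; split.
  exists M => f _; have f1 : opnorm (set_val f) = 1 by exact: (set_valP f).
  have [a Aa] := bc_nonempty A.
  have bd b : bc_set A b -> `|(set_val f : cdual X) b| <= M.
    by move=> Ab; rewrite (le_trans (opnorm_ub _ _))// f1 mul1r AM.
  rewrite ler_norml; apply/andP; split.
    have := bd a Aa; rewrite ler_norml => /andP[h _]; apply: (le_trans h).
    by apply: ub_le_sup; [have [] := support_has_sup (set_val f)|exists a].
  apply: ge_sup; first by have [] := support_has_sup (set_val f).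
  by move=> _ [b Ab <-]; rewrite (le_trans (ler_norm _))// bd.
move=> f; have Ff := @nbhs_filter (set_type (cdual_sphere X)) f.
apply/(@cvgrPdist_le _ _ _ (nbhs f) Ff) => e e0.
have vc : (fun g : set_type (cdual_sphere X) => (set_val g : cdual X)) @ f
    --> (set_val f : cdual X) by exact: initial_continuous.
have := @cvgr_dist_le _ _ _ (nbhs f) Ff _ _ vc (e / M) (divr_gt0 e0 M0).
apply: filterS => g; rewrite ler_pdivlMr// => fg.
have gf : `|(set_val g : cdual X) - set_val f| * M <= e by rewrite distrC.
rewrite ler_norml; apply/andP; split.
  rewrite lerBrDl lerBlDr (le_trans (support_lip (set_val g) (set_val f) AM))//.
  by rewrite lerD2l.
rewrite lerBlDl (le_trans (support_lip (set_val f) (set_val g) AM))//.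
by rewrite lerD2l.
Qed.

Definition radstrom : zspace X := ZSpace support_zspace.

End Radstrom.

Section Bochner.
Context {R : realType} {d : measure_display} {T : measurableType d}
  (P : probability T R) {E : normedModType R}.

Record simple_map := SimpleMap {
  simple_size : nat ;
  simple_set : 'I_simple_size -> set T ;
  simple_val : 'I_simple_size -> E ;
  simple_measurable : forall i, measurable (simple_set i) }.

Definition simple_eval (s : simple_map) (w : T) : E :=
  \sum_(i < simple_size s) \1_(simple_set i) w *: simple_val i.

Definition simple_integral (s : simple_map) : E :=
  \sum_(i < simple_size s) fine (P (simple_set i)) *: simple_val i.

(* [f] is Bochner integrable with integral [v].  As [f] is an almost
   everywhere limit of simple maps, the integrand in the second condition is
   almost everywhere equal to a measurable function; P need not be complete,
   and the library integral of a nonnegative function agrees with that of any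
   measurable function almost everywhere equal to it. *)
Definition has_bochner_integral (f : T -> E) (v : E) :=
  exists s : nat -> simple_map,
    [/\ {ae P, forall w, simple_eval (s k) w @[k --> \oo] --> f w},
        (\int[P]_w (`|f w - simple_eval (s k) w|)%:E)%E @[k --> \oo] --> 0%E
      & simple_integral (s k) @[k --> \oo] --> v].

End Bochner.

Section Probability.
Context {R : realType} {d : measure_display} {T : measurableType d}
  (P : probability T R).

Definition has_expectation {X : normedModType R} (F : T -> set X) (A : set X) :=
  exists (F' : T -> bcset X) (A' : bcset X),
    [/\ forall w, bc_set (F' w) = F w, bc_set A' = A
      & has_bochner_integral P (fun w => radstrom (F' w)) (radstrom A')].

Definition mutually_independent (Y : nat -> {RV P >-> R}) :=
  forall (J : {fset nat}) (B : nat -> set R),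
    (forall i, measurable (B i)) ->
    fine (P (\bigcap_(i in [set` J]) (Y i @^-1` B i))) =
    \prod_(i <- J) fine (P (Y i @^-1` B i)).

Definition is_fair_bernoulli (Y : {RV P >-> R}) :=
  [/\ forall w, Y w = 0 \/ Y w = 1,
      P (Y @^-1` [set 0]) = (2^-1)%:E & P (Y @^-1` [set 1]) = (2^-1)%:E].

End Probability.

(* Main.v *)
Require Import Defs.
From HB Require Import structures.
From mathcomp Require Import all_boot all_order all_algebra.
From mathcomp Require Import finmap perm.
From mathcomp Require Import all_classical all_reals all_analysis.
From mathcomp Require Import zify lra.
Import Order.TTheory GRing.Theory Num.Theory.
Import numFieldNormedType.Exports.
Local Open Scope classical_set_scope.
Local Open Scope ring_scope.

(** The set V_i belongs to block n for the least n with i < 4^n.  Block n comes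
   with one vector x_S for every subset S of {0, ..., 4^n - 1}, and V_i
   is the convex hull of 0 and of the x_S with i in S.  The number of vectors
   in a block is so large that every sign pattern is anticipated by one of
   them: given a point of Omega, let S be the set of the indices i < 4^n with
   psi_i = 1, or else its complement, and look at the coordinate on x_S.  Over
   the indices i in S that belong to block n, the sum of the psi_i V_i can
   reach their full number t in this coordinate, or else reaches 0 at most,
   while the half-sum of the V_i goes up to exactly t / 2.  Block n holds at
   least half of the indices below 4^n, so one of the two choices of S gives
   t >= 4^n / 4, and the averages over i < 4^n differ by at least 1/8 in one
   coordinate of norm at most 2 ([vset_hausdorff_dist]).  The argument is
   pointwise on Omega: no exceptional set of probability zero arises.

   This needs coordinates that are bounded with respect to the norm of X,
   with a bound that depends neither on the block nor on its size, and that
   vanish on the vectors of the earlier blocks.  They come from Auerbach's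
   determinant argument, relative to a subspace ([relative_auerbach]): fix
   linearly independent vectors e_0, ..., e_(M+N-1), and choose N vectors of
   norm at most 1 in their span so that the determinant of their last N
   coordinates, that is, their volume modulo the span of e_0, ..., e_(M-1), is
   more than half of the supremum.  By Cramer's rule, the coefficient of a
   vector w on one of them is the ratio of two such determinants up to the
   factor |w|, hence at most 2 |w|.  A linearly independent sequence e exists
   since X is infinite-dimensional, and consecutive intervals of indices serve
   consecutive blocks, so that the blocks can be chosen independently of each
   other.

   The expectation of psi_i V_i is read off a single simple function, because
   the support function of psi_i V_i is psi_i times that of V_i. *)

Set Implicit Arguments.
Unset Strict Implicit.
Unset Printing Implicit Defensive.

(** * Finite linear combinations *)

Section LinearCombinations.
Context {R : realType} {X : normedModType R}.

Definition lincomb n (e : 'I_n -> X) (c : 'rV[R]_n) : X :=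
  \sum_(i < n) c 0 i *: e i.

Lemma lincomb_is_linear n (e : 'I_n -> X) : linear (lincomb e).
Proof.
move=> a c d; rewrite /lincomb scaler_sumr -big_split/=.
by apply: eq_bigr => i _; rewrite !mxE scalerDl scalerA.
Qed.

HB.instance Definition _ n (e : 'I_n -> X) :=
  GRing.isLinear.Build R 'rV[R]_n X *:%R (lincomb e) (lincomb_is_linear e).

Lemma lincomb_mulmx m n (e : 'I_n -> X) (c : 'rV[R]_m) (A : 'M[R]_(m, n)) :
  lincomb e (c *m A) = \sum_(k < m) c 0 k *: lincomb e (row k A).
Proof.
rewrite mulmx_sum_row linear_sum/=.
by apply: eq_bigr => k _; rewrite linearZ.
Qed.

Lemma lincomb_continuous n (e : 'I_n -> X) : continuous (lincomb e).
Proof.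
apply: continuous_big => [|i _]; first exact: add_continuous.
move=> c; apply: cvgZr_tmp; first exact: nbhs_filter.
exact: (@coord_continuous R 1 n 0 i c).
Qed.

(** The equivalence of norms in finite dimension.  The norm of the combination
   has a positive minimum on each face c_i = 1 of the cube, which is compact,
   and any nonzero c is brought to a face by dividing by its largest entry. *)
Lemma lincomb_coef_bounded n (e : 'I_n -> X) :
  (forall c : 'rV[R]_n, lincomb e c = 0 -> c = 0) ->
  exists2 C : R, 0 < C &
    forall (c : 'rV[R]_n) i, `|c 0 i| <= C * `|lincomb e c|.
Proof.
move=> inj.
have face (i : 'I_n) : exists2 m : R, 0 < m & forall c : 'rV[R]_n,
    c 0 i = 1 -> (forall j, `|c 0 j| <= 1) -> m <= `|lincomb e c|.
  pose A (j : 'I_n) : set R := if j == i then [set 1] else `[-1, 1]%classic.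
  pose K := [set c : 'rV[R]_n | forall j, A j (c ord0 j)].
  have K0 : K !=set0.
    exists (delta_mx 0 i) => j; rewrite /A mxE eqxx/=.
    by case: eqVneq => //= _; rewrite in_itv/= lerN10 ler01.
  have cK : compact K.
    apply: (@rV_compact _ _ A) => j; rewrite /A.
    case: ifP => _; first exact: compact_set1.
    exact: segment_compact.
  have cf : {within K, continuous (fun c => `|lincomb e c|)}.
    apply: continuous_subspaceT => c.
    apply: continuous_comp; first exact: lincomb_continuous.
    exact: norm_continuous.
  have [c cK' cmin] := compact_EVT_min K0 cK cf.
  exists `|lincomb e c|.
    rewrite normr_gt0; apply/eqP => /inj c0; move: cK'; rewrite inE.
    move=> /(_ i); rewrite /A eqxx c0 mxE/= => /eqP.
    by rewrite eq_sym oner_eq0.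
  move=> c' ci cj; apply: cmin; rewrite inE => j.
  rewrite /A; case: eqVneq => [->//|_].
  by rewrite /= in_itv/= -ler_norml.
have /choice[m mP] : forall i, exists m : R, 0 < m /\ forall c : 'rV[R]_n,
    c 0 i = 1 -> (forall j, `|c 0 j| <= 1) -> m <= `|lincomb e c|.
  by move=> i; have [m m0 mP] := face i; exists m.
have C0 : 0 <= \sum_i (m i)^-1.
  by apply: sumr_ge0 => i _; rewrite invr_ge0 ltW//; have [] := mP i.
exists (1 + \sum_i (m i)^-1); first by rewrite ltr_pwDl.
move=> c i.
have [k kmax] : exists k, forall j, `|c 0 j| <= `|c 0 k|.
  pose k := [arg max_(k > i) `|c 0 k|]%O; exists k.
  by rewrite /k; case: arg_maxP => //= k' _ h j; apply: h.
have [ck0|ck0] := eqVneq (c 0 k) 0.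
  rewrite (le_trans (kmax i))// ck0 normr0 mulr_ge0//.
  by rewrite addr_ge0.
have [mk0 mk] := mP k.
have le1 : `|c 0 k| <= (m k)^-1 * `|lincomb e c|.
  have := mk ((c 0 k)^-1 *: c); rewrite mxE mulVf// linearZ/= normrZ.
  rewrite normfV => /(_ erefl); rewrite ler_pdivlMl ?normr_gt0//.
  rewrite ler_pdivlMl// mulrC; apply => j.
  by rewrite mxE normrM normfV ler_pdivrMl ?normr_gt0// mulr1.
rewrite (le_trans (kmax i))// (le_trans le1)// ler_wpM2r//.
rewrite (bigD1 k)//= addrCA lerDl addr_ge0// sumr_ge0// => j _.
by rewrite invr_ge0 ltW//; have [] := mP j.
Qed.

End LinearCombinations.

(** * Bounded coordinates modulo a subspace *)

Section RelativeAuerbach.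
Context {R : realType} {X : normedModType R}.

(** Cramer's rule, as the effect on the volume of replacing one vector of a
   family by a combination of the family. *)
Lemma det_replace_row N (A : 'M[R]_N) (k : 'I_N) (d : 'rV[R]_N) :
  \det (\matrix_i if i == k then d *m A else row i A) = d 0 k * \det A.
Proof.
pose E : 'M[R]_N := \matrix_i if i == k then d else row i 1%:M.
have -> : (\matrix_i if i == k then d *m A else row i A) = E *m A.
  apply/row_matrixP => i; rewrite rowK row_mul rowK.
  by case: eqP => // _; rewrite -row_mul mul1mx.
rewrite det_mulmx; congr (_ * _).
rewrite (expand_det_col _ k) (bigD1 k)//= big1 ?addr0 => [|i ik]; last first.
  by rewrite !mxE (negbTE ik) !mxE (negbTE ik) mul0r.
rewrite !mxE eqxx /cofactor exprD -expr2 sqrr_sign mul1r.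
rewrite [X in \det X](_ : _ = 1%:M) ?det1 ?mulr1//.
apply/matrixP => i j; rewrite !mxE eq_sym (negbTE (neq_lift _ _)) !mxE.
by rewrite (inj_eq lift_inj).
Qed.

Lemma det_le_bounded N (A : 'M[R]_N) (C : R) :
  (forall i j, `|A i j| <= C) -> `|\det A| <= N`!%:R * C ^+ N.
Proof.
move=> AC; rewrite (le_trans (ler_norm_sum _ _ _))//.
rewrite (@le_trans _ _ (\sum_(s : 'S_N) C ^+ N))//.
  apply: ler_sum => s _; rewrite normrM normrX normrN1 expr1n mul1r normr_prod.
  rewrite -[in leRHS](card_ord N) -prodr_const.
  by apply: ler_prod => i _; rewrite normr_ge0 AC.
by rewrite sumr_const card_Sn mulr_natl.
Qed.

(** An Auerbach system modulo the span of the first [M] vectors, up to the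
   factor 2: the rows of [Z] almost maximise the volume [\det (rsubmx Z)] among
   the families in the unit ball.  Replacing row [k] of [Z] by the normalised
   vector [z] multiplies the volume by [c 0 k] over the norm of [z], whatever
   [v] is, because [rsubmx] forgets the first [M] coordinates.  Only a volume
   above half of the supremum is asked for, which avoids a compactness
   argument on families of vectors. *)
Lemma relative_auerbach M N (e : 'I_(M + N) -> X) :
  (forall c : 'rV[R]_(M + N), lincomb e c = 0 -> c = 0) ->
  exists Z : 'M[R]_(N, M + N),
    (forall k, `|lincomb e (row k Z)| <= 1) /\
    forall (v : 'rV[R]_M) (c : 'rV[R]_N) k,
      `|c 0 k| <= 2 * `|lincomb e (row_mx v 0 + c *m Z)|.
Proof.
move=> inj; have [C C0 eC] := lincomb_coef_bounded inj.
pose ok (Z : 'M[R]_(N, M + N)) := forall k, `|lincomb e (row k Z)| <= 1.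
pose T : set R := [set `|\det (rsubmx Z)| | Z in ok].
have Tub : has_ubound T.
  exists (N`!%:R * C ^+ N) => x [Z okZ <-]; apply: det_le_bounded => i j.
  rewrite mxE; have := eC (row i Z) (rshift M j).
  rewrite mxE => /le_trans; apply.
  by rewrite -[leRHS]mulr1 ler_wpM2l ?(ltW C0)//; exact: okZ.
have [Z0 okZ0 Z0pos] : exists2 Z, ok Z & 0 < `|\det (rsubmx Z)|.
  pose t : R := (1 + \sum_i `|e i|)^-1.
  have s0 : 0 < 1 + \sum_i `|e i| by rewrite ltr_pwDl// sumr_ge0.
  have t0 : 0 < t by rewrite invr_gt0.
  exists (row_mx 0 t%:M) => [k|]; last first.
    by rewrite row_mxKr det_scalar normr_gt0 expf_neq0 ?gt_eqF.
  have -> : lincomb e (row k (row_mx 0 t%:M)) = t *: e (rshift M k).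
    rewrite /lincomb big_split_ord/= big1 ?add0r => [|i _]; last first.
      by rewrite mxE row_mxEl mxE scale0r.
    rewrite (bigD1 k)//= mxE row_mxEr mxE eqxx big1 ?addr0// => i ik.
    by rewrite mxE row_mxEr mxE eq_sym (negbTE ik) scale0r.
  rewrite normrZ gtr0_norm// ler_pdivrMl// mulr1 (bigD1 (rshift M k))//=.
  by rewrite addrCA lerDl addr_ge0// sumr_ge0.
have T0 : T !=set0 by exists `|\det (rsubmx Z0)|, Z0.
have supT : 0 < sup T.
  by rewrite (lt_le_trans Z0pos)//; apply: ub_le_sup => //; exists Z0.
have [_ [Z okZ <-] Zsup] : exists2 x, T x & sup T / 2 < x.
  apply: sup_gt => //; rewrite ltr_pdivrMr// mulr_natr mulr2n ltrDl//.
exists Z; split=> // v c k.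
set z := row_mx v 0 + c *m Z; pose w := lincomb e z.
have detZ : 0 < `|\det (rsubmx Z)| by rewrite (lt_trans _ Zsup)// divr_gt0.
have rz : rsubmx z = c *m rsubmx Z.
  rewrite /z; apply/rowP => j; rewrite !mxE (unsplitK (inr j)) mxE add0r.
  by apply: eq_bigr => i _; rewrite !mxE.
(* The scaling factor [t] is left free: it normalises [w] when [w] is nonzero,
   and is taken large when [w] is zero. *)
have rep (t : R) : `|t| * `|w| <= 1 ->
    `|t| * `|c 0 k| * `|\det (rsubmx Z)| <= sup T.
  move=> tw; pose Z' : 'M[R]_(N, M + N) :=
    \matrix_i if i == k then t *: z else row i Z.
  have -> : `|t| * `|c 0 k| * `|\det (rsubmx Z)| = `|\det (rsubmx Z')|.
    rewrite -!normrM; congr `|_|.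
    have := det_replace_row (rsubmx Z) k (t *: c).
    rewrite mxE => <-; congr (\det _); apply/row_matrixP => i.
    have rowr (B : 'M[R]_(N, M + N)) : row i (rsubmx B) = rsubmx (row i B).
      by apply/rowP => j; rewrite !mxE.
    rewrite rowK !rowr rowK; case: ifP => // _.
    by rewrite -scalemxAl -rz; apply/rowP => j; rewrite !mxE.
  apply: ub_le_sup => //; exists Z' => // i; rewrite rowK.
  by case: ifP => _; [rewrite linearZ/= normrZ|exact: okZ].
have sup2 : sup T <= 2 * `|\det (rsubmx Z)|.
  by rewrite mulrC -ler_pdivrMr// ltW.
have [w0|w0] := eqVneq w 0.
  have z0 := inj _ w0.
  have [->|ck0] := eqVneq (c 0 k) 0; first by rewrite normr0 mulr_ge0.
  have /rep : `|3 / c 0 k| * `|w| <= 1 by rewrite w0 normr0 mulr0.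
  move=> /le_trans/(_ sup2).
  by rewrite -normrM mulfVK// ler_pM2r// normr_nat ler_nat.
have := rep (`|w|^-1).
rewrite normfV normr_id mulVf ?normr_eq0// => /(_ (lexx _)).
move=> /le_trans/(_ sup2); rewrite ler_pM2r//.
by rewrite ler_pdivrMl ?normr_gt0// mulrC.
Qed.

End RelativeAuerbach.

(** * Linearly independent sequences *)

Section FreeSequences.
Context {R : realType} {X : normedModType R}.
Implicit Types (e : nat -> X) (c : nat -> R).

Definition span_upto e m : set X :=
  [set y | exists c, y = \sum_(i < m) c i *: e i].

Definition free_seq e := forall n c,
  \sum_(i < n) c i *: e i = 0 -> forall i, (i < n)%N -> c i = 0.

(** Coefficients indexed by [nat] make spans comparable for different numbers
   of vectors; this lemma and the next one translate to row vectors. *)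
Lemma row_seqP n (v : 'rV[R]_n) : exists c, v = \row_i c i.
Proof.
exists (fun i => oapp (v 0) 0 (insub i)).
by apply/rowP => i; rewrite mxE valK.
Qed.

Lemma lincomb_row e n c :
  lincomb (fun i : 'I_n => e i) (\row_i c i) = \sum_(i < n) c i *: e i.
Proof. by apply: eq_bigr => i _; rewrite mxE. Qed.

Lemma span_uptoD e m x y :
  span_upto e m x -> span_upto e m y -> span_upto e m (x + y).
Proof.
move=> [c ->] [d ->]; exists (fun i => c i + d i).
by rewrite -big_split; apply: eq_bigr => i _; rewrite scalerDl.
Qed.

Lemma span_uptoZ e m (a : R) x : span_upto e m x -> span_upto e m (a *: x).
Proof.
move=> [c ->]; exists (fun i => a * c i).
by rewrite scaler_sumr; apply: eq_bigr => i _; rewrite scalerA.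
Qed.

Lemma span_upto0 e m : span_upto e m 0.
Proof. by exists (fun=> 0); rewrite big1// => i _; rewrite scale0r. Qed.

Lemma span_upto_sum e m (I : Type) (r : seq I) (P : pred I) (F : I -> X) :
  (forall i, P i -> span_upto e m (F i)) ->
  span_upto e m (\sum_(i <- r | P i) F i).
Proof.
move=> eF; elim/big_rec: _ => [|i x Pi ex]; first exact: span_upto0.
by apply: span_uptoD => //; exact: eF.
Qed.

Lemma span_upto_le e m n x :
  (m <= n)%N -> span_upto e m x -> span_upto e n x.
Proof.
move=> mn [c ->]; exists (fun i => if (i < m)%N then c i else 0).
rewrite (big_ord_widen n (fun i => c i *: e i) mn) big_mkcond/=.
by apply: eq_bigr => i _; case: ifP => // _; rewrite scale0r.
Qed.

Lemma free_seq_exists : ~ finite_dim [set: X] -> exists e, free_seq e.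
Proof.
move=> infdim.
have /choice[f fP] : forall s : seq X, exists x, ~ lin_span s x.
  move=> s; apply: contrapT => /forallNP sP; apply: infdim.
  by exists s => x _; exact: contrapT.
pose pre n := iter n (fun s => rcons s (f s)) [::].
pose e n := f (pre n).
have preE n : pre n = mkseq e n.
  by elim: n => //= n IHn; rewrite mkseqS -IHn.
have eP n : ~ span_upto e n (e n).
  move=> [c ec]; apply: (fP (pre n)); rewrite -/(e n) ec.
  have sn : size (pre n) = n by rewrite preE size_mkseq.
  exists (fun i => c i); rewrite -(big_mkord xpredT (fun i => c i *: e i)).
  rewrite -(big_mkord xpredT (fun i => c i *: (pre n)`_i)) sn.
  by apply: eq_big_nat => i /andP[_ i_n]; rewrite preE nth_mkseq.
exists e; elim=> // n IHn c; rewrite big_ord_recr/= => c0.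
have cn0 : c n = 0.
  apply: contrapT => /eqP cn0; apply: (eP n).
  have -> : e n = - (c n)^-1 *: \sum_(i < n) c i *: e i.
    move/eqP : c0; rewrite addr_eq0 => /eqP ->.
    by rewrite scalerN scaleNr opprK scalerA mulVf// scale1r.
  by apply: span_uptoZ; exists c.
move: c0; rewrite cn0 scale0r addr0 => /IHn c0 i.
by rewrite ltnS leq_eqVlt => /predU1P[->//|]; exact: c0.
Qed.

(** The vectors of one block: they lie in the span of the first [M + N] terms
   of [e], and their coefficients ignore the span of the first [M] terms, where
   the earlier blocks live. *)
Lemma auerbach_block e M N : free_seq e ->
  exists x : 'I_N -> X, [/\ forall k, `|x k| <= 1,
    forall k, span_upto e (M + N) (x k) &
    forall y (c : 'I_N -> R) k, span_upto e M y ->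
      `|c k| <= 2 * `|y + \sum_j c j *: x j|].
Proof.
move=> efree; pose E (i : 'I_(M + N)) := e i.
have inj (v : 'rV[R]_(M + N)) : lincomb E v = 0 -> v = 0.
  have [c ->] := row_seqP v; rewrite lincomb_row => /efree c0.
  by apply/rowP => i; rewrite !mxE c0.
have [Z [Z1 Zc]] := relative_auerbach inj.
exists (fun k => lincomb E (row k Z)); split => //.
  by move=> k; have [c ->] := row_seqP (row k Z); rewrite lincomb_row; exists c.
move=> _ c k [d ->]; have := Zc (\row_i d i) (\row_j c j) k.
rewrite linearD/= lincomb_mulmx mxE => /le_trans; apply.
rewrite le_eqVlt; apply/orP; left; apply/eqP; congr (_ * `|_ + _|).
  rewrite /lincomb big_split_ord/= [X in _ + X]big1 ?addr0 => [|i _].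
    by apply: eq_bigr => i _; rewrite row_mxEl mxE.
  by rewrite row_mxEr mxE scale0r.
by apply: eq_bigr => i _; rewrite mxE.
Qed.

End FreeSequences.

(** * The convex hull of 0 and finitely many vectors *)

Section SubunitHull.
Context {R : realType} {X : normedModType R}.

Definition subsimplex n : set 'rV[R]_n :=
  [set c | (forall i, 0 <= c ord0 i) /\ \sum_i c ord0 i <= 1].

Definition hull0 n (y : 'I_n -> X) : set X := lincomb y @` @subsimplex n.

Lemma subsimplex_compact n : compact (@subsimplex n).
Proof.
pose A (i : 'I_n) : set R := `[0, 1]%classic.
pose K : set 'rV[R]_n := [set c | forall i, A i (c ord0 i)].
have cK : compact K.
  apply: (@rV_compact _ _ A) => i.
  exact: segment_compact.
have -> : @subsimplex n = K `&` [set c | \sum_i c ord0 i <= 1].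
  apply/seteqP; split=> [c [c0 c1]|c [Kc c1]]; split => // i.
    rewrite /A /= in_itv/= c0/= (le_trans _ c1)// (bigD1 i)//= lerDl sumr_ge0//.
  by have := Kc i; rewrite /A /= in_itv/= => /andP[].
apply: (subclosed_compact _ cK); last exact: subIsetl.
apply: closedI; first exact: compact_closed.
apply: (preimage_closed _ (@closed_le R 1)) => c _.
move: c; apply: continuous_big => [|i _]; first exact: add_continuous.
exact: (@coord_continuous R 1 n 0 i).
Qed.

Lemma hull0_compact n (y : 'I_n -> X) : compact (hull0 y).
Proof.
apply: continuous_compact; last exact: subsimplex_compact.
by apply: continuous_subspaceT => c; exact: lincomb_continuous.
Qed.

Lemma hull0_convex n (y : 'I_n -> X) : convex_set (hull0 y).
Proof.
move=> u v l; rewrite !inE => -[c [c0 c1] <-] [d [d0 d1] <-].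
have l0 : 0 <= l%:num by [].
have l1 : 0 <= (1 - l%:num) by rewrite subr_ge0.
exists (l%:num *: c + (1 - l%:num) *: d); last by rewrite linearP linearZ.
split=> [i|]; first by rewrite !mxE addr_ge0// mulr_ge0.
under eq_bigr do rewrite !mxE.
rewrite big_split/= -!mulr_sumr -[leRHS](subrKC l%:num 1) lerD//.
  by rewrite -[leRHS]mulr1 ler_wpM2l.
by rewrite -[leRHS]mulr1 ler_wpM2l.
Qed.

Lemma hull0_0 n (y : 'I_n -> X) : hull0 y 0.
Proof.
exists 0; last by rewrite linear0.
by split=> [i|]; [rewrite mxE|rewrite big1// => i _; rewrite mxE].
Qed.

Lemma hull0_vertex n (y : 'I_n -> X) k : hull0 y (y k).
Proof.
exists (delta_mx 0 k).
  split=> [i|]; first by rewrite mxE; case: eqP.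
  rewrite (bigD1 k)//= big1 ?addr0 => [|i ik]; rewrite mxE ?eqxx//.
  by rewrite (negbTE ik).
rewrite /lincomb (bigD1 k)//= big1 ?addr0 => [|i ik].
  by rewrite mxE !eqxx scale1r.
rewrite mxE.
by rewrite (negbTE ik) scale0r.
Qed.

Lemma hull0_unit_ball n (y : 'I_n -> X) : (forall k, `|y k| <= 1) ->
  hull0 y `<=` [set x | `|x| <= 1].
Proof.
move=> y1 _ [c [c0 c1] <-] /=; rewrite (le_trans (ler_norm_sum _ _ _))//.
apply: le_trans c1; apply: ler_sum => i _.
by rewrite normrZ ger0_norm// -[leRHS]mulr1 ler_wpM2l.
Qed.

Lemma hull0_finite_dim n (y : 'I_n -> X) : finite_dim (hull0 y).
Proof.
pose z i := oapp y 0 (insub i).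
exists (mkseq z n) => _ [v _ <-]; have [c ->] := row_seqP v.
exists (fun i => c i).
rewrite -(big_mkord xpredT (fun i => c i *: (mkseq z n)`_i)) size_mkseq.
rewrite big_mkord; apply: eq_bigr => i _.
by rewrite mxE nth_mkseq// /z valK.
Qed.

End SubunitHull.

(** * Minkowski sums and the Hausdorff distance *)

Section Minkowski.
Context {R : realType} {X : normedModType R}.
Implicit Types (A B : set X) (F : nat -> set X).

Lemma mink_scale_add (t : R) A B :
  mink_scale t (mink_add A B) = mink_add (mink_scale t A) (mink_scale t B).
Proof.
apply/seteqP; split=> x.
  move=> [_ [a Aa [b Bb <-]] <-].
  by exists (t *: a); [exists a|exists (t *: b); [exists b|rewrite scalerDr]].
move=> [_ [a Aa <-] [_ [b Bb <-] <-]].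
by exists (a + b); [exists a => //; exists b|rewrite scalerDr].
Qed.

Lemma mink_scale_sum (t : R) n F :
  mink_scale t (\mink_(i < n) F i) = \mink_(i < n) mink_scale t (F i).
Proof.
apply: big_morph; first exact: mink_scale_add.
by rewrite /mink_scale image_set1 scaler0.
Qed.

Lemma mink_scaleA (s t : R) A :
  mink_scale s (mink_scale t A) = mink_scale (s * t) A.
Proof.
rewrite /mink_scale image_comp; congr (_ @` _).
by apply/funext => x /=; rewrite scalerA.
Qed.

Lemma mink_sumP n F x : (\mink_(i < n) F i) x <->
  exists a : nat -> X,
    (forall i, (i < n)%N -> F i (a i)) /\ x = \sum_(i < n) a i.
Proof.
elim: n F x => [|n IHn] F x.
  rewrite big_ord0; split=> [->|[a [_ ->]]]; last by rewrite big_ord0.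
  by exists (fun=> 0); split => //; rewrite big_ord0.
rewrite big_ord_recl/=; split=> [[b Fb [_ /(IHn (F \o S))[a [Fa ->]] <-]]|].
  exists (fun i => if i is j.+1 then a j else b); split; last first.
    by rewrite big_ord_recl.
  by case=> // i; exact: Fa.
move=> [a [Fa ->]]; exists (a 0%N); first exact: Fa.
exists (\sum_(i < n) a i.+1); last by rewrite big_ord_recl.
by apply/(IHn (F \o S)); exists (a \o S); split => // i i_n; exact: (Fa i.+1).
Qed.

Lemma hausdorff_distC A B : hausdorff_dist A B = hausdorff_dist B A.
Proof.
rewrite /hausdorff_dist maxC.
by congr (Num.max (sup _) (sup _)); apply: eq_imagel => x _; congr inf;
  apply: eq_imagel => y _; rewrite distrC.
Qed.

(** The bound [M] on [A] makes the set of distances from points of [A] to [B]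
   bounded above, so that its [sup] is an actual supremum. *)
Lemma hausdorff_dist_ge A B (a : X) (r M : R) :
    (forall x, A x -> `|x| <= M) -> B !=set0 ->
    A a -> (forall b, B b -> r <= `|a - b|) ->
  r <= hausdorff_dist A B.
Proof.
move=> AM [b0 Bb0] Aa ar; rewrite /hausdorff_dist le_max; apply/orP; right.
have lb x : has_lbound [set `|x - b| | b in B] by exists 0 => _ [b _ <-].
apply: (@le_trans _ _ (inf [set `|a - b| | b in B])).
  apply: lb_le_inf; first by exists `|a - b0|, b0.
  by move=> _ [b Bb <-]; exact: ar.
apply: ub_le_sup; last by exists a.
exists (M + `|b0|) => _ [x Ax <-].
apply: (@le_trans _ _ `|x - b0|); first by apply: ge_inf => //; exists b0.
by rewrite (le_trans (ler_normB _ _))// lerD2r AM.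
Qed.

End Minkowski.

(** * The expectation of a Bernoulli multiple of a fixed set *)

Section Expectation.
Context {R : realType} {X : normedModType R}.

Lemma bc_scale_nonempty (t : R) (A : bcset X) : mink_scale t (bc_set A) !=set0.
Proof. by have [a Aa] := bc_nonempty A; exists (t *: a), a. Qed.

Lemma bc_scale_bounded (t : R) (A : bcset X) :
  bounded_set (mink_scale t (bc_set A)).
Proof.
have [M M0 AM] := bcset_norm A.
exists (`|t| * M); split; first exact: num_real.
move=> K tK _ [a Aa <-] /=; rewrite normrZ (le_trans _ (ltW tK))//.
by rewrite ler_wpM2l// AM.
Qed.

Lemma bc_scale_convex (t : R) (A : bcset X) :
  convex_set (mink_scale t (bc_set A)).
Proof.
move=> x y l; rewrite !inE => -[a Aa <-] [b Ab <-].
exists (l%:num *: a + (1 - l%:num) *: b).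
  by have := @bc_convex _ _ A a b l; rewrite !inE; apply.
by rewrite scalerDr !scalerA ![t * _]mulrC -!scalerA.
Qed.

Definition bc_scale (t : R) (A : bcset X) : bcset X :=
  BCSet (bc_scale_nonempty t A) (bc_scale_bounded t A) (@bc_scale_convex t A).

Lemma sup_scale (t : R) (S : set R) : 0 <= t -> has_sup S ->
  sup [set t * x | x in S] = t * sup S.
Proof.
move=> t0 [[x0 Sx0] Sub]; apply/eqP; rewrite eq_le; apply/andP; split.
  apply: ge_sup; first by exists (t * x0), x0.
  by move=> _ [x Sx <-]; rewrite ler_wpM2l// ub_le_sup.
have [->|tn0] := eqVneq t 0.
  rewrite mul0r; apply: ub_le_sup; last by exists x0; rewrite ?mul0r.
  by exists 0 => _ [x _ <-]; rewrite mul0r.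
have t_gt0 : 0 < t by rewrite lt_neqAle eq_sym tn0.
rewrite -ler_pdivlMl//; apply: ge_sup; first by exists x0.
move=> x Sx; rewrite ler_pdivlMl//; apply: ub_le_sup; last by exists x.
have [M SM] := Sub; exists (t * M) => _ [y Sy <-].
by rewrite ler_wpM2l// SM.
Qed.

Lemma radstrom_scale (t : R) (A : bcset X) :
  0 <= t -> radstrom (bc_scale t A) = t *: radstrom A.
Proof.
move=> t0; apply/val_inj/funext => f.
transitivity (t * support_fun A f); last by [].
rewrite /radstrom/= /support_fun -sup_scale//; last exact: support_has_sup.
congr sup; rewrite /mink_scale !image_comp; apply: eq_imagel => a _ /=.
have := cdual_linear (set_val f) t a 0.
rewrite !addr0 => ->; rewrite -[RHS]addr0; congr (_ + _).
have := opnorm_ub (set_val f : cdual X) 0.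
by rewrite normr0 mulr0 normr_le0 => /eqP.
Qed.

(** As [Y] only takes the values 0 and 1, the embedded random set is equal at
   every point to a simple function with the single value [radstrom A], and the
   constant sequence of this function witnesses Bochner integrability. *)
Lemma bernoulli_has_expectation d (T : measurableType d) (P : probability T R)
    (Y : {RV P >-> R}) (A : bcset X) : is_fair_bernoulli Y ->
  has_expectation P (fun w => mink_scale (Y w) (bc_set A))
                    (mink_scale 2^-1 (bc_set A)).
Proof.
move=> [Y01 _ P1].
exists (fun w => bc_scale (Y w) A), (bc_scale 2^-1 A); split => //.
have mY : measurable (Y @^-1` [set 1]) by exact: measurable_funPTI.
pose s := @SimpleMap R d T (zspace X) 1 (fun=> Y @^-1` [set 1])
  (fun=> radstrom A) (fun=> mY).
have sE w : simple_eval s w = radstrom (bc_scale (Y w) A).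
  rewrite /simple_eval big_ord1 /= indicE.
  have [Yw|Yw] := Y01 w.
    rewrite memNset /= ?Yw; last by apply/eqP; rewrite eq_sym oner_eq0.
    by rewrite radstrom_scale.
  by rewrite mem_set//= Yw radstrom_scale.
exists (fun=> s); split.
- by apply: aeW => w; rewrite sE; exact: cvg_cst.
- rewrite (_ : (fun=> _) = cst 0%E); first exact: cvg_cst.
  apply/funext => k; apply: integral0_eq => w _.
  by rewrite sE subrr normr0.
- rewrite /simple_integral big_ord1 /= P1 radstrom_scale//; exact: cvg_cst.
Qed.

End Expectation.

(** * Blocks of indices and sign patterns *)

Section Patterns.

(** The [k]-th subset of {0, ..., m-1}, as a predicate on [nat]: the same index
   [i] is tested against subsets of different ranges. *)
Definition pattern m (k : 'I_#|{: m.-tuple bool}|) (i : nat) : bool :=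
  nth false (enum_val k) i.

Lemma pattern_surj m (b : nat -> bool) :
  exists k : 'I_#|{: m.-tuple bool}|, forall i, (i < m)%N -> pattern k i = b i.
Proof.
have sz : size (mkseq b m) == m by rewrite size_mkseq.
exists (enum_rank (Tuple sz)) => i i_m.
by rewrite /pattern enum_rankK nth_mkseq.
Qed.

(** The block of [i], which is the least [n] with [i < 4 ^ n]. *)
Definition level (i : nat) : nat := up_log 4 i.+1.

Lemma level_le i n : (i < 4 ^ n)%N -> (level i <= n)%N.
Proof. exact: up_log_min. Qed.

(** The indices below [4 ^ n] that do not belong to block [n] lie below
   [4 ^ n.-1]. *)
Lemma level_half n : (4 ^ n <= 2 * \sum_(i < 4 ^ n) (level i == n))%N.
Proof.
case: n => [|n]; first by rewrite expn0 big_ord1.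
have lo (i : nat) :
    (i < 4 ^ n.+1)%N -> (1 <= (level i == n.+1) + (i < 4 ^ n))%N.
  move=> /level_le; rewrite leq_eqVlt => /predU1P[->|]; first by rewrite eqxx.
  rewrite ltnS => le_n; suff -> : (i < 4 ^ n)%N by rewrite addn1.
  by rewrite (leq_trans (@up_logP 4 i.+1 isT))// leq_exp2l.
have early : (\sum_(i < 4 ^ n.+1) (i < 4 ^ n) = 4 ^ n)%N.
  have le4 : (4 ^ n <= 4 ^ n.+1)%N by rewrite leq_exp2l.
  rewrite -[RHS]muln1 -[in RHS](card_ord (4 ^ n)) -sum_nat_const.
  rewrite (big_ord_widen _ (fun=> 1%N) le4) [RHS]big_mkcond.
  by apply: eq_bigr => i _; case: (i < 4 ^ n)%N.
have := @leq_sum _ (index_enum 'I_(4 ^ n.+1)) xpredT (fun=> 1%N)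
  (fun i => (level i == n.+1) + (i < 4 ^ n))%N (fun i _ => lo i (ltn_ord i)).
rewrite big_split/= early sum_nat_const card_ord muln1 expnS.
by move: (\sum_(_ < _) _)%N => A; lia.
Qed.

End Patterns.

(** * The sets V_i and their separation *)

Section Construction.
Context {R : realType} {X : normedModType R}.
Variables (e : nat -> X) (efree : free_seq e).

Definition block_size n := #|{: (4 ^ n).-tuple bool}|.
Definition block_start n := (\sum_(k < n) block_size k)%N.

Lemma block_startS n : block_start n.+1 = (block_start n + block_size n)%N.
Proof. by rewrite /block_start big_ord_recr. Qed.

Definition block_vec n : 'I_(block_size n) -> X :=
  sval (cid (auerbach_block (block_start n) (block_size n) efree)).

Lemma block_vecP n : [/\ forall k, `|@block_vec n k| <= 1,
  forall k, span_upto e (block_start n.+1) (@block_vec n k) &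
  forall y (c : 'I_(block_size n) -> R) k, span_upto e (block_start n) y ->
    `|c k| <= 2 * `|y + \sum_j c j *: block_vec j|].
Proof.
rewrite block_startS.
exact: (svalP (cid (auerbach_block (block_start n) (block_size n) efree))).
Qed.

Lemma block_start_le m n : (m <= n)%N -> (block_start m <= block_start n)%N.
Proof.
move=> mn; rewrite -(subnK mn); elim: (n - m)%N => // k IHk.
by rewrite addSn (leq_trans IHk)// block_startS leq_addr.
Qed.

Definition vset (i : nat) : set X :=
  hull0 (fun k : 'I_(block_size (level i)) => (pattern k i)%:R *: block_vec k).

Lemma vset_unit_ball i : vset i `<=` [set x | `|x| <= 1].
Proof.
apply: hull0_unit_ball => k; have [x1 _ _] := block_vecP (level i).
by case: pattern; rewrite ?scale1r ?scale0r ?normr0.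
Qed.

Section Coordinate.
Variables (n : nat) (k : 'I_(block_size n)).

(** The value [r] at [v] of the coordinate functional of [block_vec k], on the
   span of block [n] and of the first [block_start n] terms of [e], as a
   relation: this functional never has to be extended to X.  By [coord_le], the
   relation is single-valued and the functional has norm at most 2. *)
Definition coord (v : X) (r : R) := exists y (c : 'I_(block_size n) -> R),
  [/\ span_upto e (block_start n) y,
      v = y + \sum_j c j *: block_vec j & r = c k].

Lemma coord_le (u v : X) (p q : R) :
  coord u p -> coord v q -> p - q <= 2 * `|u - v|.
Proof.
move=> [y [c [ey -> ->]]] [z [d [ez -> ->]]].
have [_ _ sep] := block_vecP n.
have eyz : span_upto e (block_start n) (y - z).
  by rewrite -scaleN1r; apply: span_uptoD => //; exact: span_uptoZ.
rewrite (le_trans (ler_norm _))//.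
rewrite (le_trans (sep _ (fun j => c j - d j) k eyz))//.
rewrite ler_wpM2l// le_eqVlt; apply/orP; left; apply/eqP; congr `|_|.
rewrite opprD addrACA; congr (_ + _); rewrite -sumrB.
by apply: eq_bigr => j _; rewrite scalerBl.
Qed.

Lemma coordD u v p q : coord u p -> coord v q -> coord (u + v) (p + q).
Proof.
move=> [y [c [ey -> ->]]] [z [d [ez -> ->]]].
exists (y + z), (fun j => c j + d j); split => //; first exact: span_uptoD.
rewrite addrACA; congr (_ + _); rewrite -big_split.
by apply: eq_bigr => j _; rewrite scalerDl.
Qed.

Lemma coordZ (a : R) u p : coord u p -> coord (a *: u) (a * p).
Proof.
move=> [y [c [ey -> ->]]]; exists (a *: y), (fun j => a * c j).
split => //; first exact: span_uptoZ.
rewrite scalerDr scaler_sumr; congr (_ + _).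
by apply: eq_bigr => j _; rewrite scalerA.
Qed.

Lemma coord0 y : span_upto e (block_start n) y -> coord y 0.
Proof.
move=> ey; exists y, (fun=> 0); split=> //.
by rewrite big1 ?addr0// => j _; rewrite scale0r.
Qed.

Lemma coord_sum m (v : nat -> X) (r : nat -> R) :
  (forall i, (i < m)%N -> coord (v i) (r i)) ->
  coord (\sum_(i < m) v i) (\sum_(i < m) r i).
Proof.
move=> vr; elim/big_rec2: _ => [|i q u _ uq].
  by apply: coord0; exact: span_upto0.
by apply: coordD => //; exact: vr.
Qed.

Lemma coord_block_vec : coord (block_vec k) 1.
Proof.
exists 0, (fun j => (j == k)%:R); split; first exact: span_upto0.
  rewrite add0r (bigD1 k)//= eqxx scale1r big1 ?addr0// => j jk.
  by rewrite (negbTE jk) scale0r.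
by rewrite eqxx.
Qed.

(** The indices [i] for which the coordinate on [block_vec k] is not identically
   zero on [vset i], among the blocks up to [n]. *)
Definition sees (i : nat) : bool := (level i == n) && pattern k i.

(** For [i] in block [n] the coordinate is read off the convex combination; for
   [i] in an earlier block it is 0, as [vset i] lies in the span of the first
   [block_start n] terms of [e]. *)
Lemma vset_coord i v : (i < 4 ^ n)%N -> vset i v ->
  exists r, coord v r /\ r <= (sees i)%:R.
Proof.
move=> i_n [c [c0 c1] <-]; have := level_le i_n; rewrite leq_eqVlt.
rewrite /sees /coord; case/orP => [/eqP E|lt_n].
  case: n / E k => k'; rewrite eqxx/=.
  exists (c ord0 k' * (pattern k' i)%:R); split.
    exists 0, (fun j => c ord0 j * (pattern j i)%:R); split => //.
      exact: span_upto0.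
    by rewrite add0r; apply: eq_bigr => j _; rewrite scalerA.
  rewrite -[leRHS]mul1r ler_wpM2r// (le_trans _ c1)//.
  by rewrite (bigD1 k')//= lerDl sumr_ge0.
exists 0; split=> //; apply: coord0; apply: span_upto_sum => j _.
apply/span_uptoZ/span_uptoZ; apply: span_upto_le (block_start_le lt_n) _.
by have [_ + _] := block_vecP (level i); apply.
Qed.

Lemma vset_vertex i : vset i (if sees i then block_vec k else 0).
Proof.
rewrite /sees; case: ifP => [/andP[/eqP E]|_]; last exact: hull0_0.
case: n / E k => k' ki; rewrite -[block_vec k']scale1r.
have := hull0_vertex
  (fun j : 'I_(block_size (level i)) => (pattern j i)%:R *: block_vec j) k'.
by rewrite ki.
Qed.

(** Separation of two weighted averages by one coordinate.  The point of the
   first average that uses the vector [block_vec k] wherever it is available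
   has coordinate [\sum_i s i * sees i], up to normalisation, and no point of
   the second exceeds [\sum_i t i * sees i]; the factor 2 bounds the norm of
   the coordinate functional. *)
Lemma hausdorff_dist_sees (s t : nat -> R) :
    (forall i, 0 <= s i) -> (forall i, 0 <= t i) ->
  (4 ^+ n)^-1 * \sum_(i < 4 ^ n) (s i - t i) * (sees i)%:R <=
  2 * hausdorff_dist
    (mink_scale (4 ^+ n)^-1 (\mink_(i < 4 ^ n) mink_scale (s i) (vset i)))
    (mink_scale (4 ^+ n)^-1 (\mink_(i < 4 ^ n) mink_scale (t i) (vset i))).
Proof.
move=> s0 t0; rewrite -ler_pdivrMl//.
pose F (u : nat -> R) i := mink_scale (u i) (vset i).
pose w i := if sees i then @block_vec n k else 0.
apply: (@hausdorff_dist_ge _ _ _ _ ((4 ^+ n)^-1 *: \sum_(i < 4 ^ n) s i *: w i)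
  _ ((4 ^+ n)^-1 * \sum_(i < 4 ^ n) s i)).
- move=> _ [_ /(mink_sumP _ (F s))[a [aV ->]] <-].
  rewrite normrZ ger0_norm// ler_wpM2l// (le_trans (ler_norm_sum _ _ _))//.
  apply: ler_sum => i _; have [v /vset_unit_ball v1 <-] := aV i (ltn_ord i).
  by rewrite normrZ ger0_norm// -[leRHS]mulr1 ler_wpM2l.
- exists 0, 0; last by rewrite scaler0.
  apply/(mink_sumP _ (F t)); exists (fun=> 0); split; last by rewrite big1.
  by move=> i _; exists 0; [exact: hull0_0|rewrite scaler0].
- exists (\sum_(i < 4 ^ n) s i *: w i) => //.
  apply/(mink_sumP _ (F s)); exists (fun i => s i *: w i); split => // i _.
  by exists (w i) => //; exact: vset_vertex.
move=> _ [_ /(mink_sumP _ (F t))[a [aV ->]] <-].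
have /choice[r rP] : forall i, exists r, (i < 4 ^ n)%N ->
    coord (a i) r /\ r <= t i * (sees i)%:R.
  move=> i; have [i_n|] := ltnP i (4 ^ n); last by exists 0.
  have [v Vv <-] := aV i i_n; have [r [vr rs]] := vset_coord i_n Vv.
  by exists (t i * r) => _; split; [exact: coordZ|rewrite ler_wpM2l].
have cw i : coord (w i) (sees i)%:R.
  rewrite /w; case: ifP => _; first exact: coord_block_vec.
  by apply: coord0; exact: span_upto0.
rewrite ler_pdivrMl//.
apply: le_trans (coord_le
  (coordZ _ (coord_sum (fun i _ => coordZ (s i) (cw i))))
  (coordZ _ (coord_sum (fun i i_n => (rP i i_n).1)))).
rewrite -mulrBr ler_wpM2l// -sumrB; apply: ler_sum => i _.
by rewrite mulrBl lerB// (rP i (ltn_ord i)).2.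
Qed.

End Coordinate.

(** Either the indices with [s i = 1] or those with [s i = 0] fill half of block
   [n], hence a quarter of the indices below [4 ^ n].  With the pattern that
   selects the larger class, the weights [s] and 1/2 differ by 1/2 at each
   selected index: the coordinates differ by 1/8 or more, and the distance is
   at least half of that.  For the class [s i = 0] it is the half-sum that has the
   larger coordinate, and the two sets exchange their roles. *)
Lemma vset_hausdorff_dist n (s : nat -> R) : (forall i, s i = 0 \/ s i = 1) ->
  16^-1 <= hausdorff_dist
    (mink_scale (4 ^+ n)^-1 (\mink_(i < 4 ^ n) mink_scale (s i) (vset i)))
    (mink_scale (4 ^+ n)^-1 (\mink_(i < 4 ^ n) mink_scale 2^-1 (vset i))).
Proof.
move=> s01; have s0 i : 0 <= s i by have [->|->] := s01 i.
pose t b : R := \sum_(i < 4 ^ n) ((level i == n) && ((s i == 1) == b))%:R.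
have tt : 4 ^+ n <= 2 * (t true + t false).
  rewrite /t -big_split/= -natrX.
  rewrite (_ : \sum_(i < 4 ^ n) _ = (\sum_(i < 4 ^ n) (level i == n))%:R).
    by rewrite -natrM ler_nat level_half.
  rewrite natr_sum; apply: eq_bigr => i _.
  by case: (level i == n); case: (s i == 1); rewrite /= ?addr0 ?add0r.
have p4 : 0 < 4 ^+ n :> R by rewrite exprn_gt0.
have big b : 4 ^+ n <= 4 * t b -> 8^-1 <= (4 ^+ n)^-1 * (2^-1 * t b).
  by rewrite ler_pdivlMl//; lra.
have half b (u : nat -> R) : (forall i, (s i == 1) == b -> u i = 2^-1) ->
    exists k, \sum_(i < 4 ^ n) u i * (@sees n k i)%:R = 2^-1 * t b.
  move=> u2; have [k kP] := pattern_surj (4 ^ n) (fun i => (s i == 1) == b).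
  exists k; rewrite mulr_sumr; apply: eq_bigr => i _; rewrite /sees kP//.
  by case: (boolP ((s i == 1) == b)) => [/u2->//|_]; rewrite andbF !mulr0.
have h0 : 0 <= 2^-1 :> R by [].
have [t1|t1] := lerP (4 ^+ n) (4 * t true).
  have [k kE] : exists k, \sum_(i < 4 ^ n) (s i - 2^-1) * (@sees n k i)%:R =
      2^-1 * t true.
    by apply: (half true (fun i => s i - 2^-1)) => i /eqP/eqP->; lra.
  have := hausdorff_dist_sees k s0 (fun=> h0); rewrite kE.
  by have := big _ t1; lra.
have [k kE] : exists k, \sum_(i < 4 ^ n) (2^-1 - s i) * (@sees n k i)%:R =
    2^-1 * t false.
  apply: (half false (fun i => 2^-1 - s i)) => i /eqP/negbT.
  have [->|->] := s01 i; last by rewrite eqxx.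
  by rewrite subr0.
have := hausdorff_dist_sees k (fun=> h0) s0; rewrite kE hausdorff_distC.
have /big : 4 ^+ n <= 4 * t false by lra.
by lra.
Qed.

End Construction.

(** * The counterexample to the law of large numbers *)

(* psi i and V i are the paper's psi_(i+1) and V_(i+1) *)
Theorem theorem3p4 (R : realType) (d : measure_display)
    (Omega : measurableType d) (P : probability Omega R)
    (psi : nat -> {RV P >-> R})
    (psi_bernoulli : forall i, is_fair_bernoulli (psi i))
    (psi_indep : mutually_independent psi)
    (X : completeNormedModType R)
    (X_infinite_dim : ~ finite_dim [set: X]) :
  exists (V : nat -> set X) (eps : R),
    let Psi := fun (i : nat) (w : Omega) => mink_scale (psi i w) (V i) in
    let EPsi := fun i : nat => mink_scale 2^-1 (V i) in
    [/\ forall i, [/\ V i !=set0, finite_dim (V i), compact (V i),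
                      convex_set (V i) & V i `<=` [set x | `|x| <= 1]],
        0 < eps,
        forall i, has_expectation P (Psi i) (EPsi i),
        forall (w : Omega) (n : nat),
          hausdorff_dist (mink_scale (4 ^+ n)^-1 (\mink_(i < 4 ^ n) Psi i w))
                         (mink_scale (4 ^+ n)^-1 (\mink_(i < 4 ^ n) EPsi i)) =
          hausdorff_dist
            (mink_scale (4 ^+ n)^-1 (\mink_(i < 4 ^ n) mink_scale (psi i w) (V i)))
            (mink_scale (4 ^+ n * 2)^-1 (\mink_(i < 4 ^ n) V i)) /\
          eps <= hausdorff_dist
            (mink_scale (4 ^+ n)^-1 (\mink_(i < 4 ^ n) Psi i w))
            (mink_scale (4 ^+ n)^-1 (\mink_(i < 4 ^ n) EPsi i))
      & forall w : Omega,
          ~ (hausdorff_dist (mink_scale N%:R^-1 (\mink_(i < N) Psi i w))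
                            (mink_scale N%:R^-1 (\mink_(i < N) EPsi i))
             @[N --> \oo] --> (0 : R))].
Proof.
have [e efree] := free_seq_exists X_infinite_dim.
pose V := vset efree.
have V0 i : V i !=set0 by exists 0; exact: hull0_0.
have Vb i : bounded_set (V i).
  exists 1; split=> // M M1 v /(vset_unit_ball (i:=i)) v1.
  exact: le_trans v1 (ltW M1).
have Vc i : convex_set (V i) by exact: hull0_convex.
exists V, 16^-1 => Psi EPsi.
have far w n : 16^-1 <= hausdorff_dist
    (mink_scale (4 ^+ n)^-1 (\mink_(i < 4 ^ n) Psi i w))
    (mink_scale (4 ^+ n)^-1 (\mink_(i < 4 ^ n) EPsi i)).
  apply: (@vset_hausdorff_dist _ _ e efree n (fun i => psi i w)) => i.
  by have [+ _ _] := psi_bernoulli i; apply.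
split => //.
- move=> i; split => //; [exact: hull0_finite_dim|exact: hull0_compact|].
  exact: vset_unit_ball.
- move=> i.
  exact: (bernoulli_has_expectation (BCSet (V0 i) (Vb i) (Vc i))
    (psi_bernoulli i)).
- move=> w n; split; last exact: far.
  by rewrite -(@mink_scale_sum _ _ 2^-1 _ V) mink_scaleA -invfM.
have eps0 : 0 < 16^-1 :> R by [].
move=> w /cvgr0Pnorm_lt/(_ 16^-1 eps0).
move=> [N _ /(_ (4 ^ N)%N)] /(_ (ltnW (ltn_expl N (isT : 1 < 4)%N))) /=.
rewrite natrX => /(le_lt_trans (ler_norm _)).
by rewrite ltNge far.
Qed.
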